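(* Suppose that $f:\mathbb{R}^n\to\mathbb{R}$ is differentiable with $L_f$-Lipschitz continuous gradient ($L_f>0$), that $g:\mathbb{R}^n\to\overline{\mathbb{R}}$ is proper, lower semicontinuous and convex, and that $\operatorname{argmin}\varphi\neq\emptyset$ where $\varphi=f+g$. Consider the iterates generated by the PANOC-lite algorithm (described in the context) and suppose that $\hat x^k$ converges to a strong local minimizer $x^\star$ of $\varphi$. Suppose further that the directions $(\bar d^k)_{k\in\mathbb{N}}$ are superlinear with respect to $(\bar x^k)_{k\in\mathbb{N}}$, in the sense that $$\lim_{k\to\infty}\frac{\|\bar x^k+\bar d^k-\bar x^\star\|}{\|\bar x^k-\bar x^\star\|}=0,\qquad\text{where }\bar x^\star:=x^\star-\gamma\nabla f(x^\star).$$ Then $\tau_k=1$ is accepted for all sufficiently large $k$, and $(\hat x^k)_{k\in\mathbb{N}}$ converges superlinearly to $x^\star$, i.e. $\lim_{k\to\infty}\|\hat x^{k+1}-x^\star\|/\|\hat x^k-x^\star\|=0$.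
   Context: $\overline{\mathbb{R}}=\mathbb{R}\cup\{+\infty\}$, $\mathbb{N}=\{0,1,2,\dots\}$, $\|\cdot\|$ is the Euclidean norm. $\operatorname{prox}_{\gamma g}(x)=\operatorname{argmin}_u\{g(u)+\frac1{2\gamma}\|u-x\|^2\}$, $T_\gamma(x)=\operatorname{prox}_{\gamma g}(x-\gamma\nabla f(x))$, and $R^{\rm nat}_\gamma(x)=\gamma^{-1}(x-T_\gamma(x))$. A point $x^\star$ with $\varphi(x^\star)<\infty$ is a strong local minimizer of $\varphi$ if there exist $\mu>0$ and a neighborhood $U$ of $x^\star$ such that $\varphi(x)\ge\varphi(x^\star)+\frac\mu2\|x-x^\star\|^2$ for all $x\in U$. A limit of quotients presupposes that the quotients are well defined (nonzero denominators) for all sufficiently large $k$. PANOC-lite algorithm. Parameters: $x^0\in\mathbb{R}^n$, $\gamma\in(0,2/L_f)$, $\beta\in(0,1)$, $\sigma\in\bigl(0,\gamma\frac{2-\gamma L_f}{2}\bigr)$. Initialize $\hat x^0=\operatorname{prox}_{\gamma g}(x^0)$. For $k=0,1,2,\dots$: set $\bar x^k=\hat x^k-\gamma\nabla f(\hat x^k)$ and $R^{\rm nat}_\gamma(\hat x^k)=\gamma^{-1}(\hat x^k-\operatorname{prox}_{\gamma g}(\bar x^k))$; select an arbitrary direction $\bar d^k\in\mathbb{R}^n$ and let $x^{k+1}=\bar x^k+\tau_k\bar d^k$, $\hat x^{k+1}=\operatorname{prox}_{\gamma g}(x^{k+1})$, where $\tau_k$ is the largest element of $\{\beta^i\mid i\in\mathbb{N}\}$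 such that the linesearch condition $\varphi(\hat x^{k+1})-\varphi(\hat x^k)\le-\sigma\|R^{\rm nat}_\gamma(\hat x^k)\|^2$ holds. ''Generated by the algorithm'' means infinite sequences of iterates satisfying these relations for all $k\in\mathbb{N}$. *)

(* Defs.v *)
From mathcomp Require Import all_boot all_order all_algebra.
From mathcomp Require Import all_classical all_reals all_analysis.
Import Order.TTheory GRing.Theory Num.Theory.
Import numFieldNormedType.Exports.

Set Implicit Arguments.
Unset Strict Implicit.
Unset Printing Implicit Defensive.

Local Open Scope classical_set_scope.
Local Open Scope ring_scope.

(* The library norm [`|x|] on row vectors is the sup norm. It induces the same
   topology as [enorm], so [nbhs], [-->], [differentiable] and
   [lower_semicontinuous] keep their usual meaning; every quantitative estimate
   is stated with [enorm]. *)
Definition enorm (R : realType) (n : nat) (x : 'rV[R]_n) : R :=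
  Num.sqrt (\sum_(j < n) x 0 j ^+ 2).

Definition grad (R : realType) (n : nat) (f : 'rV[R]_n -> R) (x : 'rV[R]_n) :
    'rV[R]_n :=
  \row_(j < n) 'D_(delta_mx 0 j) f x.

Definition lipschitz_gradient (R : realType) (n : nat) (L : R)
    (f : 'rV[R]_n -> R) : Prop :=
  forall x y, enorm (grad f x - grad f y) <= L * enorm (x - y).

(* Functions into R U {+oo} are functions into [\bar R] that avoid -oo; this
   restriction is part of properness. *)
Definition eproper (R : realType) (n : nat) (g : 'rV[R]_n -> \bar R) : Prop :=
  (forall x, g x != -oo%E) /\ (exists x, (g x < +oo)%E).

(* The library convention 0 * +oo = 0 makes the endpoints t = 0, 1 trivial. *)
Definition econvex (R : realType) (n : nat) (g : 'rV[R]_n -> \bar R) : Prop :=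
  forall (x y : 'rV[R]_n) (t : R), 0 <= t <= 1 ->
    (g (t *: x + (1 - t) *: y)%R <= t%:E * g x + (1 - t)%:E * g y)%E.

Definition argmin (R : realType) (n : nat) (h : 'rV[R]_n -> \bar R) :
    set 'rV[R]_n :=
  [set x | forall y, (h x <= h y)%E].

Definition objective (R : realType) (n : nat) (f : 'rV[R]_n -> R)
    (g : 'rV[R]_n -> \bar R) (x : 'rV[R]_n) : \bar R :=
  ((f x)%:E + g x)%E.

(* [get] selects an element of the argmin, which is a singleton for gamma > 0
   and g proper, lower semicontinuous and convex. *)
Definition prox (R : realType) (n : nat) (gamma : R) (g : 'rV[R]_n -> \bar R)
    (x : 'rV[R]_n) : 'rV[R]_n :=
  get (argmin (fun u => g u + ((2 * gamma)^-1 * enorm (u - x)%R ^+ 2)%:E)%E).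

Definition fwd (R : realType) (n : nat) (gamma : R) (f : 'rV[R]_n -> R)
    (x : 'rV[R]_n) : 'rV[R]_n :=
  x - gamma *: grad f x.

Definition Rnat (R : realType) (n : nat) (gamma : R) (f : 'rV[R]_n -> R)
    (g : 'rV[R]_n -> \bar R) (x : 'rV[R]_n) : 'rV[R]_n :=
  gamma^-1 *: (x - prox gamma g (fwd gamma f x)).

Definition strong_local_minimizer (R : realType) (n : nat)
    (h : 'rV[R]_n -> \bar R) (xs : 'rV[R]_n) : Prop :=
  (h xs < +oo)%E /\
  exists2 mu : R, 0 < mu &
    \forall x \near xs, (h xs + (mu / 2 * enorm (x - xs)%R ^+ 2)%:E <= h x)%E.

(* Acceptance of the stepsize t at the point [xh], with xbar = fwd gamma f xh
   and direction [d]. Values of prox lie in the domain of g, so that the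
   difference of extended reals below is a difference of real numbers. *)
Definition linesearch (R : realType) (n : nat) (gamma sigma : R)
    (f : 'rV[R]_n -> R) (g : 'rV[R]_n -> \bar R) (xh d : 'rV[R]_n) (t : R) :
    Prop :=
  (objective f g (prox gamma g (fwd gamma f xh + t *: d)%R) - objective f g xh
     <= (- sigma * enorm (Rnat gamma f g xh) ^+ 2)%:E)%E.

Record panoc_lite (R : realType) (n : nat) (gamma beta sigma : R)
    (f : 'rV[R]_n -> R) (g : 'rV[R]_n -> \bar R)
    (x xhat xbar dbar : nat -> 'rV[R]_n) (tau : nat -> R) : Prop := PanocLite {
  panoc_init : xhat 0%N = prox gamma g (x 0%N);
  panoc_xbar : forall k, xbar k = fwd gamma f (xhat k);
  panoc_x : forall k, x k.+1 = xbar k + tau k *: dbar k;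
  panoc_xhat : forall k, xhat k.+1 = prox gamma g (x k.+1);
  panoc_tau_pow : forall k, exists i : nat, tau k = beta ^+ i;
  panoc_tau_accept : forall k,
    linesearch gamma sigma f g (xhat k) (dbar k) (tau k);
  panoc_tau_largest : forall k (i : nat),
    linesearch gamma sigma f g (xhat k) (dbar k) (beta ^+ i) ->
    beta ^+ i <= tau k }.

(* Division by 0 is total in the library, hence the first conjunct. *)
Definition quotient_to0 (R : realType) (u v : nat -> R) : Prop :=
  (\forall k \near \oo, v k != 0) /\ (u k / v k @[k --> \oo] --> (0 : R)).

(* Main.v *)
Require Import Defs.
From mathcomp Require Import all_boot all_order all_algebra.
From mathcomp Require Import all_classical all_reals all_analysis.
From mathcomp Require Import ring lra.
Import Order.TTheory GRing.Theory Num.Theory.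
Import numFieldNormedType.Exports.
Local Open Scope classical_set_scope.
Local Open Scope ring_scope.

(** The proof compares the objective phi = f + g at three points: the current
    iterate w = xhat k, its forward-backward image T, and the candidate
    z = prox (xbar k + dbar k) produced by the unit step.

    Both prox points and the limit xs are described by one relation, a
    subgradient of g: (y - prox y) / gamma is a subgradient of g at prox y, and
    minus the gradient of f is one at xs because xs is a local minimizer. The
    two facts have a common source ([subgradient_of_quadratic_error]): a convex
    function that is minimal up to a linear term and a quadratic error satisfies
    the exact linear inequality. Hence xs is itself the prox of
    xbars = xs - gamma grad f xs, and monotonicity of subgradients makes prox
    nonexpansive ([prox_nonexpansive]).

    Although phi need not be smooth, at prox points its growth above phi xs is
    quadratic: adding the subgradient inequality at z and the descent lemma for
    f at xs, the first-order terms recombine into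
      phi z - phi xs <= |xbar k + dbar k - xbars|^2 / gamma
    ([objective_prox_gap], where gamma Lf < 2 absorbs the remaining square).
    Superlinear directions make the right-hand side o(|w - xs|^2), and strong
    local minimality bounds |w - xs|^2 by a multiple of phi w - phi xs. So the
    unit step cuts the optimality gap of w by an arbitrarily small factor. On
    the other hand the forward-backward step at w decreases phi by
    delta |Rnat w|^2 with delta = gamma (2 - gamma Lf) / 2
    ([forward_backward_decrease]); since T tends to xs, phi T is eventually at
    least phi xs, so the gap of w is at least delta |Rnat w|^2. As
    sigma < delta, the linesearch condition holds with the unit step
    ([unit_step_accepted]).

    Once tau k = 1, nonexpansiveness gives
    |xhat (k+1) - xs| <= |xbar k + dbar k - xbars| = o(|xbar k - xbars|), and
    the forward map is Lipschitz, which is superlinear convergence.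

    The points prox y are selected by a choice operator, so that the
    subgradient relation first requires the argmin to be nonempty
    ([prox_exists]): a lower semicontinuous convex g has a minorant of linear
    growth, the prox objective is therefore coercive, and it attains its minimum
    on a compact ball. *)

Set Implicit Arguments.
Unset Strict Implicit.
Unset Printing Implicit Defensive.

(** * The Euclidean inner product and norm *)

Definition edot (R : realType) (n : nat) (u v : 'rV[R]_n) : R :=
  \sum_(j < n) u 0 j * v 0 j.

Section Edot.
Context (R : realType) (n : nat).
Implicit Types (u v w : 'rV[R]_n) (c : R).

Lemma edotC u v : edot u v = edot v u.
Proof. by apply: eq_bigr => j _; rewrite mulrC. Qed.

Lemma edotDl u v w : edot (u + v) w = edot u w + edot v w.
Proof. by rewrite /edot -big_split; apply: eq_bigr => j _; rewrite mxE mulrDl. Qed.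

Lemma edotZl c u v : edot (c *: u) v = c * edot u v.
Proof. by rewrite /edot mulr_sumr; apply: eq_bigr => j _; rewrite mxE mulrA. Qed.

Lemma edotNl u v : edot (- u) v = - edot u v.
Proof. by rewrite -scaleN1r edotZl mulN1r. Qed.

Lemma edotDr u v w : edot w (u + v) = edot w u + edot w v.
Proof. by rewrite !(edotC w) edotDl. Qed.

Lemma edotZr c u v : edot u (c *: v) = c * edot u v.
Proof. by rewrite !(edotC u) edotZl. Qed.

Lemma edotNr u v : edot u (- v) = - edot u v.
Proof. by rewrite !(edotC u) edotNl. Qed.

Set Implicit Arguments.
Unset Strict Implicit.
Unset Printing Implicit Defensive.

Definition edotE := (edotDl, edotDr, edotZl, edotZr, edotNl, edotNr).

Lemma edot_ge0 u : 0 <= edot u u.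
Proof. by apply: sumr_ge0 => j _; rewrite -expr2 sqr_ge0. Qed.

Lemma enorm_ge0 u : 0 <= enorm u.
Proof. exact: sqrtr_ge0. Qed.

Lemma enorm_sqr u : enorm u ^+ 2 = edot u u.
Proof. by rewrite sqr_sqrtr// sumr_ge0// => j _; rewrite sqr_ge0. Qed.

(** Expand the square of [c^-1 *: u - v]. The free weight [c] makes this a
    substitute for the Cauchy-Schwarz inequality. *)
Lemma edot_young c u v : 0 < c ->
  edot u v <= c^-1 / 2 * enorm u ^+ 2 + c / 2 * enorm v ^+ 2.
Proof.
move=> c0; have := edot_ge0 (c^-1 *: u - v).
rewrite !enorm_sqr !edotE (edotC v u) => h.
have : 0 <= c / 2 * (c^-1 * (c^-1 * edot u u) - c^-1 * edot u v +
   (- (c^-1 * edot u v) + edot v v)).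
  by apply: mulr_ge0; [lra|apply: le_trans h _; lra].
have -> : c / 2 * (c^-1 * (c^-1 * edot u u) - c^-1 * edot u v +
   (- (c^-1 * edot u v) + edot v v)) =
   c^-1 / 2 * edot u u + c / 2 * edot v v - edot u v.
  by field; rewrite gt_eqF.
by rewrite subr_ge0.
Qed.

Lemma coord_le_enorm u j : `|u 0 j| <= enorm u.
Proof.
rewrite -(@ler_pXn2r _ 2)// ?nnegrE ?enorm_ge0// enorm_sqr real_normK ?num_real//.
rewrite /edot (bigD1 j)//= -expr2 lerDl.
by apply: sumr_ge0 => i _; rewrite -expr2 sqr_ge0.
Qed.

Lemma mxnorm_le_enorm u : `|u| <= enorm u.
Proof.
rewrite [`|u|]mx_normrE; apply/bigmax_leP; split; first exact: enorm_ge0.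
by case=> i j _ /=; rewrite (ord1 i) coord_le_enorm.
Qed.

Lemma enormZ c u : enorm (c *: u) = `|c| * enorm u.
Proof.
apply/eqP; rewrite -(@eqrXn2 _ 2)// ?mulr_ge0 ?enorm_ge0// exprMn.
by rewrite !enorm_sqr !edotE real_normK ?num_real// expr2 mulrA.
Qed.

Lemma continuous_enorm : continuous (@enorm R n).
Proof.
move=> u; apply: (@continuous_comp _ R R _ Num.sqrt); last exact: sqrt_continuous.
suff h : \sum_(j < n) v 0 j ^+ 2 @[v --> u] --> \sum_(j < n) u 0 j ^+ 2 by exact: h.
apply: (@cvg_big R _ +%R 0 xpredT add_continuous _ (nbhs u) _
  (fun j v => v 0 j ^+ 2)) => j _.
have h : (fun v : 'rV[R]_n => v 0 j) @ u --> u 0 j by exact: coord_continuous.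
by rewrite expr2; apply: cvgM.
Qed.

(** Transfers limits between the library topology, given by the sup norm, and
    the Euclidean estimates: one direction is continuity of [enorm], the other
    the domination of the sup norm by [enorm]. *)
Lemma cvg_enormP (T : Type) (F : set_system T) (w : T -> 'rV[R]_n) u :
  Filter F -> (w @ F --> u) <-> (enorm (w k - u) @[k --> F] --> (0:R)).
Proof.
move=> FF; split => h.
  have : w k - u @[k --> F] --> u - u by apply: cvgB => //; exact: cvg_cst.
  rewrite subrr => h'; rewrite -[0 in X in _ --> X](_ : @enorm R n 0 = 0).
  by apply: continuous_cvg h'; exact: continuous_enorm.
by rewrite -[0](scale0r 0) enormZ normr0 mul0r.
apply/cvgrPdist_le => e e0; move/cvgrPdist_le : h => /(_ e e0).
apply: filterS => k; rewrite sub0r normrN => h.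
rewrite distrC (le_trans (mxnorm_le_enorm _))//.
by rewrite (le_trans _ h)// ler_norm.
Qed.

End Edot.

(** * The descent lemma *)

Lemma derive_grad (R : realType) (n : nat) (f : 'rV[R]_n -> R) (x d : 'rV[R]_n) :
  differentiable f x -> 'D_d f x = edot (grad f x) d.
Proof.
move=> fx; rewrite deriveE// {1}[d]row_sum_delta linear_sum/=.
by apply: eq_bigr => j _; rewrite linearZ/= mxE deriveE// mulrC.
Qed.

(** The difference quotient of [f] along the line is literally the directional
    one, so no chain rule is involved. *)
Lemma is_derive_line (R : realType) (n : nat) (f : 'rV[R]_n -> R)
    (x d : 'rV[R]_n) (t : R) : differentiable f (x + t *: d) ->
  is_derive t 1 (fun s => f (x + s *: d)) (edot (grad f (x + t *: d)) d).
Proof.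
move=> fx; rewrite -derive_grad//.
have E : (fun h : R => h^-1 *: (((fun s => f (x + s *: d)) \o shift t) (h *: 1) -
            f (x + t *: d))) =
  (fun h : R => h^-1 *: ((f \o shift (x + t *: d)) (h *: d) - f (x + t *: d))).
  apply/funext => h; congr (_ *: (f _ - _)).
  by rewrite /= [h *: 1]mulr1 scalerDl [RHS]addrC -addrA [t *: d + _]addrC.
apply: DeriveDef.
  by rewrite /derivable E; exact: diff_derivable.
by rewrite /derive E.
Qed.

(** The mean value theorem is applied to [f (x + t *: d)] minus the whole
    quadratic model in [t]: applied to [f (x + t *: d)] alone it would give the
    constant [L] instead of [L / 2], and the sharp constant is what the range
    [gamma < 2 / L] of stepsizes depends on. *)
Lemma descent_lemma (R : realType) (n : nat) (f : 'rV[R]_n -> R) (L : R)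
    (x d : 'rV[R]_n) :
  (forall z, differentiable f z) -> lipschitz_gradient L f -> 0 < L ->
  f (x + d) <= f x + edot (grad f x) d + L / 2 * enorm d ^+ 2.
Proof.
move=> fdiff flip L0.
pose G t := edot (grad f (x + t *: d)) d.
pose psi (t : R) :=
  f (x + t *: d) - (t * edot (grad f x) d + t ^+ 2 * (L / 2 * enorm d ^+ 2)).
have dpsi (t : R) : is_derive t 1 psi
    (G t - (edot (grad f x) d + t * (L * enorm d ^+ 2))).
  have h := is_derive_line (fdiff (x + t *: d)).
  rewrite /psi; apply: is_derive_eq.
  by rewrite /GRing.scale/= /G; field.
have [|c +] := @MVT R psi _ 0 1 ltr01 (fun t _ => dpsi t).
  apply: derivable_within_continuous => t _; exact: (@ex_derive _ _ _ _ _ _ _ (dpsi t)).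
rewrite in_itv/= => /andP[c0 c1].
rewrite /psi scale0r scale1r expr0n expr1n/= !mul0r !mul1r !addr0 !subr0 mulr1 => E.
(* The weight [L * c] balances the two squares, since [grad f] moves by at
   most [L * c * enorm d] between [x] and [x + c *: d]. *)
have := edot_young (grad f (x + c *: d) - grad f x) d (mulr_gt0 L0 c0).
have : enorm (grad f (x + c *: d) - grad f x) ^+ 2 <= (L * c) ^+ 2 * enorm d ^+ 2.
  rewrite -exprMn ler_pXn2r ?nnegrE ?mulr_ge0 ?enorm_ge0 ?(ltW L0) ?(ltW c0)//.
  apply: le_trans (flip _ _) _; rewrite addrAC subrr add0r enormZ gtr0_norm//.
  by rewrite mulrA.
set N := enorm (_ - _) ^+ 2; rewrite edotDl edotNl -/(G c) => hN hY.
have : (L * c)^-1 / 2 * N <= L * c / 2 * enorm d ^+ 2.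
  have Lc : 0 < L * c by rewrite mulr_gt0.
  rewrite -(ler_pM2l Lc).
  have -> : L * c * ((L * c)^-1 / 2 * N) = N / 2 by field; rewrite !gt_eqF.
  lra.
lra.
Qed.

(** * Lower semicontinuous functions *)

Section lsc_min.
Local Open Scope ereal_scope.

Lemma lsc_open_gt (T : topologicalType) (R : realType) (h : T -> \bar R) (a : \bar R) :
  lower_semicontinuous h -> open [set x | a < h x].
Proof.
move=> /lower_semicontinuousP hl; case: a => [r||]; first exact: hl.
  rewrite (_ : [set _ | _] = set0); first exact: open0.
  by apply/seteqP; split=> // x /=; rewrite ltNge leey.
rewrite (_ : [set _ | _] = \bigcup_(r in [set: R]) [set x | r%:E < h x]).
  by apply: bigcup_open => r _; exact: hl.
apply/seteqP; split=> [x|x [r _]] /=; last exact: lt_trans (ltNyr r).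
case hx : (h x) => [s||] // _.
  by exists (s - 1)%R => //=; rewrite hx lte_fin ltrBlDr ltrDl.
by exists 0%R => //=; rewrite hx; exact: ltry.
Qed.

(** If there were no minimizer, the open sets [h t < h x] indexed by [t] in [K]
    would cover [K]; the best index of a finite subcover is in none of them. *)
Lemma lsc_compact_min (T : ptopologicalType) (R : realType) (h : T -> \bar R)
    (K : set T) :
  lower_semicontinuous h -> compact K -> K !=set0 ->
  exists2 z, K z & forall u, K u -> h z <= h u.
Proof.
move=> hl Kc [x0 Kx0]; apply: contrapT => nomin.
have cov : K `<=` \bigcup_(t in K) [set x | h t < h x].
  move=> x Kx; apply: contrapT => nx; apply: nomin; exists x => // u Ku.
  by rewrite leNgt; apply/negP => hu; apply: nx; exists u.
move: Kc; rewrite compact_cover => /(_ _ K _ _ cov)[|D DK Dcov].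
  by move=> t _; exact: lsc_open_gt.
(* A point of [K] at least as good as finitely many others; starting from [x0]
   covers the empty subfamily. *)
have best : forall s : seq T, (forall x, x \in s -> K x) ->
    exists2 t, K t & forall x, x \in s -> h t <= h x.
  elim=> [|y s IH] sK; first by exists x0.
  have [|t Kt tmin] := IH; first by move=> x xs; apply: sK; rewrite inE xs orbT.
  have Ky : K y by apply: sK; rewrite inE eqxx.
  have [ty|/ltW yt] := leP (h t) (h y).
    by exists t => // x; rewrite inE => /predU1P[->|/tmin].
  exists y => // x; rewrite inE => /predU1P[->//|/tmin]; exact: le_trans.
have [x /DK|t Kt tmin] := best (finmap.enum_fset D); first by rewrite inE.
have [u uD /=] := Dcov _ Kt.
by rewrite ltNge tmin.
Qed.

End lsc_min.

Lemma lsc_addr_continuous (T : topologicalType) (R : realType)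
    (h : T -> \bar R) (q : T -> R) :
  lower_semicontinuous h -> continuous q ->
  lower_semicontinuous (fun x => h x + (q x)%:E)%E.
Proof.
move=> hl qc x a ahq.
have [b [ab bh]] : exists b : R, a - q x < b /\ (b%:E < h x)%E.
  move: ahq; case: (h x) => [s||].
  - rewrite -EFinD lte_fin => ahq; exists ((a - q x + s) / 2).
    by rewrite lte_fin; split; lra.
  - by move=> _; exists (a - q x + 1); rewrite ltry ltrDl.
  - by [].
have [V Vx hV] := hl _ _ bh.
have nq : \forall y \near x, a - b < q y.
  by apply: (cvgr_gt _ (qc x)); lra.
exists (V `&` [set y | a - b < q y]); first exact: filterI.
move=> y [/hV hy /= qy]; rewrite (@lt_trans _ _ (b%:E + (q y)%:E)%E)//.
  by rewrite -EFinD lte_fin; lra.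
by rewrite lteD2rE.
Qed.

(** * Proximal points and subgradients *)

Definition subgradient (R : realType) (n : nat) (g : 'rV[R]_n -> \bar R)
    (z v : 'rV[R]_n) : Prop :=
  g z \is a fin_num /\
  forall u, (g z + (edot v (u - z)%R)%:E <= g u)%E.

Section ConvexFunction.
Context (R : realType) (n : nat) (g : 'rV[R]_n -> \bar R).
Hypotheses (g_proper : eproper g) (g_convex : econvex g).

Let gNy u : (-oo < g u)%E.
Proof. by rewrite ltNye; case: g_proper => + _; apply. Qed.

Lemma econvex_fine (x y : 'rV[R]_n) (a b t : R) : g x = a%:E -> g y = b%:E ->
  0 <= t <= 1 -> (g (t *: x + (1 - t) *: y)%R <= (t * a + (1 - t) * b)%:E)%E.
Proof. by move=> gx gy /(g_convex x y); rewrite gx gy. Qed.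

(** Lower semicontinuity bounds [g] from below by [g x0 - 1] on a small ball, and
    convexity propagates the bound along rays from [x0]: a point [u] outside the
    ball has a point of the segment from [x0] to [u] inside it, whose value is
    controlled by [g x0] and [g u]. This replaces the separation theorem usually
    invoked for affine minorants. *)
Lemma convex_lsc_minorant (x0 : 'rV[R]_n) : lower_semicontinuous g ->
  (g x0 < +oo)%E ->
  exists A B : R, 0 <= B /\ forall u, ((A - B * `|u - x0|)%:E <= g u)%E.
Proof.
move=> glsc gx0.
have [G gG] : exists G : R, g x0 = G%:E.
  by exists (fine (g x0)); rewrite fineK// fin_numElt gNy gx0.
have [|V /nbhs_ballP[r /= r0 rV] Vg] := glsc x0 (G - 1).
  by rewrite gG lte_fin; lra.
have rg u : `|u - x0| < r -> ((G - 1)%:E < g u)%E.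
  by move=> ur; apply/Vg/rV; rewrite -ball_normE/= distrC.
exists (G - 1), (r / 2)^-1; split; first by rewrite invr_ge0; lra.
move=> u; set s := `|u - x0|.
have s0 : 0 <= s by exact: normr_ge0.
have [sr|rs] := leP s (r / 2).
  apply: (@le_trans _ _ (G - 1)%:E); last by apply/ltW/rg; rewrite -/s; lra.
  by rewrite lee_fin gerBl mulr_ge0// invr_ge0; lra.
case gu : (g u) (gNy u) => [a||] // _; last exact: leey.
(* The weight for which the convex combination is at distance [r / 2] of [x0]. *)
pose t := r / 2 / s.
have sp : 0 < s by lra.
have t0 : 0 < t by rewrite /t !divr_gt0.
have t1 : t <= 1 by rewrite /t ler_pdivrMr// mul1r ltW.
have := econvex_fine gu gG (t := t).
rewrite (ltW t0) t1 => /(_ isT) h.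
have /rg : `|t *: u + (1 - t) *: x0 - x0| < r.
  rewrite scalerBl scale1r addrCA addrAC subrr add0r -scalerBr normrZ gtr0_norm//.
  by rewrite -/s /t divfK ?gt_eqF//; lra.
move=> /lt_le_trans/(_ h); rewrite lte_fin lee_fin => {}h.
have E : (r / 2)^-1 * s = t^-1 by rewrite mulrC /t [RHS]invf_div.
rewrite E.
have : 0 < t^-1 * (t * a + (1 - t) * G - (G - 1)) by rewrite mulr_gt0 ?invr_gt0//; lra.
have -> : t^-1 * (t * a + (1 - t) * G - (G - 1)) = a - G + t^-1.
  by field; rewrite gt_eqF.
lra.
Qed.

(** The quadratic term beats the linear decrease of the minorant, so that the
    values outside a large ball exceed the value at a point of the domain; the
    minimum over the compact ball is then global. *)
Lemma prox_exists (gamma : R) (x : 'rV[R]_n) : lower_semicontinuous g -> 0 < gamma ->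
  argmin (fun u => g u + ((2 * gamma)^-1 * enorm (u - x)%R ^+ 2)%:E)%E
    (prox gamma g x).
Proof.
move=> glsc gamma0; rewrite /prox.
suff : argmin (fun u => g u + ((2 * gamma)^-1 * enorm (u - x)%R ^+ 2)%:E)%E !=set0.
  exact: getPex.
set q := fun u => _.
have qlsc : lower_semicontinuous q.
  apply: lsc_addr_continuous => // u.
  have h : enorm (v - x) @[v --> u] --> enorm (u - x).
    have h : v - x @[v --> u] --> u - x.
      exact: cvgB cvg_id (cvg_cst x).
    by apply: continuous_cvg h; exact: continuous_enorm.
  suff : (2 * gamma)^-1 * (enorm (v - x) * enorm (v - x)) @[v --> u] -->
      (2 * gamma)^-1 * (enorm (u - x) * enorm (u - x)) by exact.
  by exact: cvgMl_tmp (cvgM h h).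
have [_ [x0 gx0]] := g_proper.
have [A [B [B0 gAB]]] := convex_lsc_minorant glsc gx0.
pose c := (2 * gamma)^-1.
have c0 : 0 < c by rewrite invr_gt0 mulr_gt0.
have [Q qx0] : exists Q : R, q x0 = Q%:E.
  by exists (fine (q x0)); rewrite fineK// fin_numD fin_numElt gNy gx0.
pose D := `|x - x0|.
(* Beyond this radius, with [p] the distance from [u] to [x], both [c * p - B >= 1]
   and [p >= Q - A + B * D] hold; then [c * p ^+ 2 - B * p >= Q - A + B * D]. *)
pose M := D + (B + 1) / c + `|Q - A + B * D|.
have D0 : 0 <= D by exact: normr_ge0.
have E0 : 0 <= `|Q - A + B * D| by exact: normr_ge0.
have Bc0 : 0 <= (B + 1) / c by rewrite divr_ge0 ?ltW//; lra.
have M0 : 0 <= M by rewrite /M; lra.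
have Kcpt : compact [set u : 'rV[R]_n | `|u - x0| <= M].
  apply: bounded_closed_compact.
    exists (M + `|x0|); split; first exact: num_real.
    move=> r Mr u /= uM; apply: le_trans (ltW Mr).
    by rewrite -[u](subrK x0) (le_trans (ler_normD _ _))// lerD2r.
  rewrite (_ : mkset _ = closed_ball_ Num.norm x0 M); first exact: closed_closed_ball_.
  by apply/seteqP; split => u; rewrite /closed_ball_/= distrC.
have [|z Kz zmin] := lsc_compact_min qlsc Kcpt.
  by exists x0; rewrite /= subrr normr0.
exists z => u.
have [uM|uM] := leP `|u - x0| M; first exact: zmin.
apply: (@le_trans _ _ (q x0)).
  by apply: zmin; rewrite /= subrr normr0.
rewrite qx0 /q.
have hs : `|u - x0| <= enorm (u - x) + D.
  rewrite -[u](subrK x) -addrA (le_trans (ler_normD _ _))// addrK lerD2r.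
  exact: mxnorm_le_enorm.
apply: (@le_trans _ _
  ((A - B * `|u - x0|)%:E + (c * enorm (u - x) ^+ 2)%:E)%E); last first.
  by apply: leeD => //; exact: gAB.
rewrite -EFinD lee_fin.
set s := `|u - x0| in hs uM *; set p := enorm (u - x) in hs *.
have p1 : (B + 1) / c <= p by move: hs uM; rewrite /M; lra.
have p2 : Q - A + B * D <= p.
  by apply: le_trans (ler_norm _) _; move: hs uM; rewrite /M; lra.
have cp : B + 1 <= c * p by rewrite -ler_pdivrMl// mulrC.
have p0 : 0 <= p by exact: enorm_ge0.
have : 0 <= (c * p - B - 1) * p by rewrite mulr_ge0//; lra.
have : 0 <= B * (p + D - s) by rewrite mulr_ge0//; lra.
by rewrite expr2; lra.
Qed.
(** Fermat's rule for a local inequality with quadratic error. At distance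
    [t * enorm (u - z)] on the segment from [z] to [u], convexity makes the
    linear terms of order [t] while the error is of order [t ^+ 2]: dividing by
    [t] and letting it tend to 0 removes the error and gives the inequality for
    every [u], not only near [z]. *)
Lemma subgradient_of_quadratic_error (z v : 'rV[R]_n) (C : R) :
  g z \is a fin_num ->
  (\forall u \near z,
     g z + (edot v (u - z)%R)%:E <= g u + (C * enorm (u - z)%R ^+ 2)%:E)%E ->
  subgradient g z v.
Proof.
move=> gz nz; split=> // u.
case gu : (g u) (gNy u) => [b||] // _; last exact: leey.
have [a ga] : exists a, g z = a%:E by exists (fine (g z)); rewrite fineK.
rewrite ga -EFinD lee_fin.
set X := edot v (u - z); set Q := C * enorm (u - z) ^+ 2.
have line t : t *: u + (1 - t) *: z = z + t *: (u - z).
  by rewrite scalerBl scale1r scalerBr addrC -addrA; congr (_ + _); rewrite addrC.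
have line_cvg : (t *: u + (1 - t) *: z) @[t --> (0:R)^'+] --> z.
  have : z + t *: (u - z) @[t --> (0:R)^'+] --> z + 0 *: (u - z).
    by apply: cvgD; [exact: cvg_cst|apply: cvgZr_tmp; exact: cvg_at_right_filter cvg_id].
  by rewrite scale0r addr0 -(funext line).
have small : \forall t \near (0:R)^'+, a + X - b <= t * Q.
  near=> t.
  have t0 : 0 < t by near: t; exact: nbhs_right_gt.
  have t1 : t <= 1 by near: t; exact: nbhs_right_le.
  have h : (g z + (edot v (t *: (u - z)))%:E <=
      g (t *: u + (1 - t) *: z)%R + (C * enorm (t *: (u - z))%R ^+ 2)%:E)%E.
    suff : (g z + (edot v (t *: u + (1 - t) *: z - z)%R)%:E <=
      g (t *: u + (1 - t) *: z)%R +
      (C * enorm (t *: u + (1 - t) *: z - z)%R ^+ 2)%:E)%E.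
      by rewrite line addrAC subrr add0r.
    by near: t; exact: (line_cvg _ nz).
  have := econvex_fine gu ga (t := t).
  rewrite (ltW t0) t1 => /(_ isT) k.
  have {}k := le_trans h (leeD2r _ k); move: k.
  rewrite ga -!EFinD lee_fin edotZr enormZ gtr0_norm// -/X exprMn => k.
  rewrite -(ler_pM2l t0) /Q; move: k; set N := enorm _ ^+ 2; lra.
have Q0 : t * Q @[t --> (0:R)^'+] --> 0 * Q.
  by apply: cvgMr_tmp; exact: cvg_at_right_filter cvg_id.
rewrite mul0r in Q0.
suff : a + X - b <= 0 by lra.
rewrite -(cvg_lim _ Q0)//; apply: limr_ge small; exact: (cvgP _ Q0).
Unshelve. all: by end_near.
Qed.

(** Expanding the square around [prox gamma g y], minimality is the subgradient
    inequality up to the error [(2 * gamma)^-1 * enorm (u - z) ^+ 2]. *)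
Lemma prox_subgradient (gamma : R) (y : 'rV[R]_n) :
  lower_semicontinuous g -> 0 < gamma ->
  subgradient g (prox gamma g y) (gamma^-1 *: (y - prox gamma g y)).
Proof.
move=> glsc gamma0; have := prox_exists y glsc gamma0.
set z := prox gamma g y => zmin.
have gz : g z \is a fin_num.
  have [_ [x0 gx0]] := g_proper.
  rewrite fin_numElt gNy/=; move: (zmin x0) gx0.
  by case: (g z) => [r||] //; case: (g x0) => [s||] //= *; rewrite ltry.
apply: (subgradient_of_quadratic_error (C := (2 * gamma)^-1)) => //.
near=> u; have := zmin u.
rewrite !enorm_sqr -[u - y](subrK (z - y)).
rewrite (_ : u - y - (z - y) = u - z); last by rewrite opprB addrA subrK.
rewrite !edotE.
case: (g u) (gNy u) => [b||] // _; last by move=> _; rewrite addye// leey.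
have [a ga] : exists a, g z = a%:E by exists (fine (g z)); rewrite fineK.
rewrite ga -!EFinD !lee_fin invfM.
rewrite (edotC z u) (edotC z y) (edotC y u).
set i := gamma^-1; lra.
Unshelve. all: by end_near.
Qed.

End ConvexFunction.

(** Adding the two subgradient inequalities, each tested at the other point,
    gives [edot (z1 - z2) (z1 - z2) <= edot (y1 - y2) (z1 - z2)]; the claim
    follows from the nonnegativity of the square of [(y1 - y2) - (z1 - z2)]. *)
Lemma prox_nonexpansive (R : realType) (n : nat) (g : 'rV[R]_n -> \bar R)
    (gamma : R) (y1 y2 z1 z2 : 'rV[R]_n) : 0 < gamma ->
  subgradient g z1 (gamma^-1 *: (y1 - z1)) ->
  subgradient g z2 (gamma^-1 *: (y2 - z2)) ->
  enorm (z1 - z2) <= enorm (y1 - y2).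
Proof.
move=> gamma0 [g1 h1] [g2 h2].
move: (h1 z2) (h2 z1); rewrite -(fineK g1) -(fineK g2) -!EFinD !lee_fin.
rewrite !edotZl; set a := fine _; set b := fine _ => k1 k2.
have : gamma^-1 * (edot (y1 - z1) (z2 - z1) + edot (y2 - z2) (z1 - z2)) <= 0 by lra.
rewrite pmulr_rle0 ?invr_gt0// => k.
rewrite -(@ler_pXn2r _ 2)// ?nnegrE ?enorm_ge0// !enorm_sqr.
have := edot_ge0 ((y1 - y2) - (z1 - z2)); move: k.
rewrite !edotE !(edotC z1 y1) !(edotC z1 y2) !(edotC z2 y1) !(edotC z2 y2).
rewrite !(edotC z2 z1) !(edotC y2 y1).
lra.
Qed.

(** * Estimates on the composite objective *)

Section CompositeObjective.
Context (R : realType) (n : nat) (f : 'rV[R]_n -> R) (g : 'rV[R]_n -> \bar R).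
Context (L gamma : R).
Hypotheses (f_diff : forall z : 'rV[R]_n, differentiable f z)
  (f_lip : lipschitz_gradient L f) (L_gt0 : 0 < L) (gamma_gt0 : 0 < gamma)
  (gammaL : gamma * L < 2).

Let half_L_lt : L / 2 < gamma^-1.
Proof. by rewrite -(ltr_pM2l gamma_gt0) mulfV ?gt_eqF// mulrA ltr_pdivrMr ?mul1r. Qed.

(** By the descent lemma, local minimality of [f + g] says that [g] is minimal
    at [xs] up to the linear term of [f] and an error of [L / 2] times the
    squared distance. *)
Lemma local_minimizer_stationary (xs : 'rV[R]_n) :
  eproper g -> econvex g -> (objective f g xs < +oo)%E ->
  (\forall x \near xs, (objective f g xs <= objective f g x)%E) ->
  subgradient g xs (- grad f xs).
Proof.
move=> gprop gconv; rewrite /objective => fgxs xsmin.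
have gxs : g xs \is a fin_num.
  rewrite fin_numElt ltNye gprop.1/=.
  by case: (g xs) fgxs => [r||] // _; rewrite ltry.
apply: (subgradient_of_quadratic_error gprop gconv (C := L / 2)) => //.
apply: filterS xsmin => u.
have := descent_lemma xs (u - xs) f_diff f_lip L_gt0.
rewrite [xs + _]addrC subrK edotNl -(fineK gxs).
case: (g u) (gprop.1 u) => [b||] // _; last by move=> *; rewrite addye// leey.
by rewrite -!EFinD !lee_fin; lra.
Qed.

(** Stationarity read as a prox relation: [xs] is the proximal point of
    [fwd gamma f xs]. *)
Lemma subgradient_fwd (xs : 'rV[R]_n) :
  subgradient g xs (- grad f xs) ->
  subgradient g xs (gamma^-1 *: (fwd gamma f xs - xs)).
Proof.
rewrite /fwd addrAC subrr add0r scalerN scalerA mulVf ?gt_eqF//.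
by rewrite scale1r.
Qed.

(** Quadratic growth of the objective at proximal points, in the absence of any
    smoothness of [g]. With [p = y - fwd gamma f xs] and [d = z - xs], the
    gradient terms cancel between the subgradient inequality at [z] and the
    descent lemma at [xs], leaving
    [gamma^-1 * edot p d - (gamma^-1 - L / 2) * enorm d ^+ 2]. *)
Lemma objective_prox_gap (xs y z : 'rV[R]_n) :
  subgradient g xs (- grad f xs) -> subgradient g z (gamma^-1 *: (y - z)) ->
  (objective f g z <=
     objective f g xs + (gamma^-1 * enorm (y - fwd gamma f xs)%R ^+ 2)%:E)%E.
Proof.
move=> sxs sz.
have nonexp : enorm (z - xs) ^+ 2 <= enorm (y - fwd gamma f xs) ^+ 2.
  rewrite ler_pXn2r ?nnegrE ?enorm_ge0//.
  apply: (prox_nonexpansive gamma_gt0 sz).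
  exact: subgradient_fwd.
have := descent_lemma xs (z - xs) f_diff f_lip L_gt0.
rewrite [xs + _]addrC subrK.
case: sxs => gxs _; case: sz => gz /(_ xs).
rewrite /objective -(fineK gxs) -(fineK gz) -!EFinD !lee_fin.
have i0 : 0 < gamma^-1 by rewrite invr_gt0.
have yE : y - z = (y - fwd gamma f xs) - gamma *: grad f xs - (z - xs).
  by apply/rowP => j; rewrite /fwd !mxE; ring.
rewrite yE edotZl -(opprB z xs) !edotNr.
move: nonexp (edot_young (y - fwd gamma f xs) (z - xs) ltr01).
move: (y - fwd gamma f xs) (z - xs) => p d; rewrite invr1.
rewrite !edotDl !edotNl edotZl -enorm_sqr.
set P := enorm p ^+ 2; set D := enorm d ^+ 2; set e := edot p d.
set G := edot (grad f xs) d => hD he h1 h2.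
have D0 : 0 <= D by exact: sqr_ge0.
have : 0 <= (gamma^-1 - L / 2) * D by rewrite mulr_ge0// subr_ge0 ltW.
have : 0 <= gamma^-1 * (P - e) by rewrite mulr_ge0 ?(ltW i0)//; lra.
have E : gamma^-1 * (gamma * G) = G by rewrite mulrA mulVf ?mul1r// gt_eqF.
move: h1; rewrite !mulrN !mulrDr !mulrN E; lra.
Qed.

(** The subgradient inequality at [z], tested at [w], plus the descent lemma at
    [w]. *)
Lemma forward_backward_decrease (w z : 'rV[R]_n) :
  g w \is a fin_num -> subgradient g z (gamma^-1 *: (fwd gamma f w - z)) ->
  (objective f g z + ((gamma^-1 - L / 2) * enorm (w - z)%R ^+ 2)%:E
     <= objective f g w)%E.
Proof.
move=> gw [gz /(_ w)].
have := descent_lemma w (z - w) f_diff f_lip L_gt0.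
rewrite [w + _]addrC subrK /objective -(fineK gw) -(fineK gz) -!EFinD !lee_fin.
have -> : fwd gamma f w - z = (w - z) - gamma *: grad f w by rewrite /fwd addrAC.
rewrite -(opprB w z) edotNr !enorm_sqr edotZl edotDl !edotNl edotNr edotZl.
set G := edot _ _; set D := edot _ _.
have E : gamma^-1 * (gamma * G) = G by rewrite mulrA mulVf ?mul1r// gt_eqF.
rewrite mulrBr E; lra.
Qed.

Lemma fwd_lipschitz (x y : 'rV[R]_n) :
  enorm (fwd gamma f x - fwd gamma f y) ^+ 2
    <= 2 * (1 + (gamma * L) ^+ 2) * enorm (x - y) ^+ 2.
Proof.
have := f_lip x y.
have -> : fwd gamma f x - fwd gamma f y = (x - y) - gamma *: (grad f x - grad f y).
  by apply/rowP => j; rewrite /fwd !mxE; ring.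
rewrite -(@ler_pXn2r _ 2)// ?nnegrE ?mulr_ge0 ?enorm_ge0 ?(ltW L_gt0)//.
rewrite !exprMn !enorm_sqr; move: (x - y) (grad f x - grad f y) => d v h.
have := edot_ge0 (d + gamma *: v).
have : 0 <= gamma ^+ 2 * (L ^+ 2 * edot d d - edot v v).
  by rewrite mulr_ge0 ?sqr_ge0// subr_ge0.
rewrite !edotE (edotC v d); lra.
Qed.

(** With [theta = 1 - sigma / delta], the direction is good enough for the unit
    step to shrink the gap [phi w - phi xs] to at most [theta] times its value,
    a decrease of at least [sigma / delta] times the gap; and the gap itself is
    at least [delta] times the squared residual, because the forward-backward
    step realizes that decrease without going below [phi xs]. *)
Lemma unit_step_accepted (sigma mu : R) (xs w d : 'rV[R]_n) :
  let delta := gamma * ((2 - gamma * L) / 2) in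
  eproper g -> econvex g -> lower_semicontinuous g ->
  0 < sigma -> sigma < delta -> subgradient g xs (- grad f xs) ->
  g w \is a fin_num ->
  (objective f g xs + (mu / 2 * enorm (w - xs)%R ^+ 2)%:E <= objective f g w)%E ->
  (objective f g xs <= objective f g (prox gamma g (fwd gamma f w)))%E ->
  enorm (fwd gamma f w + d - fwd gamma f xs) ^+ 2
    <= (1 - sigma / delta) * (gamma * (mu / 2)) * enorm (w - xs) ^+ 2 ->
  linesearch gamma sigma f g w d 1.
Proof.
move=> delta gprop gconv glsc sigma0 sigma_delta sxs gw growth Tmin dir.
have sz := prox_subgradient gprop gconv (fwd gamma f w + d) glsc gamma_gt0.
have sT := prox_subgradient gprop gconv (fwd gamma f w) glsc gamma_gt0.
have gap := objective_prox_gap sxs sz.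
have dec := forward_backward_decrease gw sT.
rewrite /linesearch scale1r /Rnat enormZ exprMn.
rewrite gtr0_norm ?invr_gt0//.
move: gap dec growth Tmin dir sz.1 sT.1 sxs.1.
rewrite /objective.
move: (prox gamma g (fwd gamma f w + d)) (prox gamma g (fwd gamma f w)) => z T.
move=> + + + + + gz gT gxs.
rewrite -(fineK gw) -(fineK gz) -(fineK gT) -(fineK gxs) -!EFinD. rewrite !lee_fin.
set fz := f z + _; set fw := f w + _; set fs := f xs + _; set fT := f T + _.
set N := enorm (w - T) ^+ 2; set D := enorm (w - xs) ^+ 2.
set Y := enorm (_ + _ - _) ^+ 2 => gap dec growth Tmin dir.
have delta0 : 0 < delta by lra.
pose theta := 1 - sigma / delta.
have theta0 : 0 <= theta by rewrite /theta subr_ge0 ler_pdivrMr// mul1r ltW.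
have gapD : gamma^-1 * Y <= theta * (mu / 2 * D).
  rewrite -(ler_pM2l gamma_gt0) mulrA mulfV ?gt_eqF// mul1r.
  by apply: le_trans dir _; rewrite -/theta le_eqVlt; apply/orP; left; apply/eqP; ring.
have growth' : theta * (mu / 2 * D) <= theta * (fw - fs).
  by rewrite ler_wpM2l//; lra.
have decN : delta * (gamma^-1 ^+ 2 * N) = (gamma^-1 - L / 2) * N.
  by rewrite /delta; field; rewrite gt_eqF.
have : sigma / delta * (delta * (gamma^-1 ^+ 2 * N)) <= sigma / delta * (fw - fs).
  by rewrite ler_wpM2l ?divr_ge0 ?(ltW sigma0) ?(ltW delta0)// decN; lra.
rewrite mulrA divfK ?gt_eqF// => last_step.
have : fz - fs <= theta * (fw - fs) by lra.
by rewrite mulNr /theta mulrBl mul1r; lra.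
Qed.

End CompositeObjective.

(** * Superlinear convergence *)

Theorem theorem10 (R : realType) (n : nat)
  (f : 'rV[R]_n -> R) (g : 'rV[R]_n -> \bar R) (Lf gamma beta sigma : R)
  (x xhat xbar dbar : nat -> 'rV[R]_n) (tau : nat -> R) (xs : 'rV[R]_n)
  (Lf_gt0 : 0 < Lf)
  (f_diff : forall z : 'rV[R]_n, differentiable f z)
  (f_lip : lipschitz_gradient Lf f)
  (g_proper : eproper g)
  (g_lsc : lower_semicontinuous g)
  (g_convex : econvex g)
  (argmin_neq0 : argmin (objective f g) !=set0)
  (gamma_itv : 0 < gamma < 2 / Lf)
  (beta_itv : 0 < beta < 1)
  (sigma_itv : 0 < sigma < gamma * ((2 - gamma * Lf) / 2))
  (iterates : panoc_lite gamma beta sigma f g x xhat xbar dbar tau)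
  (xhat_cvg : xhat k @[k --> \oo] --> xs)
  (xs_min : strong_local_minimizer (objective f g) xs)
  (dbar_superlinear :
    quotient_to0 (fun k => enorm (xbar k + dbar k - fwd gamma f xs))
                 (fun k => enorm (xbar k - fwd gamma f xs))) :
  (\forall k \near \oo, tau k = 1) /\
  quotient_to0 (fun k => enorm (xhat k.+1 - xs))
               (fun k => enorm (xhat k - xs)).
Proof.
have /andP[gamma0 gammaL] := gamma_itv; rewrite ltr_pdivlMr// in gammaL.
have /andP[sigma0 sigma_delta] := sigma_itv.
have [fgxs [mu mu0 growth]] := xs_min.
have xs_loc : \forall u \near xs, (objective f g xs <= objective f g u)%E.
  apply: filterS growth => u; apply: le_trans.
  by rewrite leeDl// lee_fin mulr_ge0 ?sqr_ge0// divr_ge0// ltW.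
have sxs := local_minimizer_stationary f_diff f_lip Lf_gt0 g_proper g_convex fgxs xs_loc.
have sxs' := subgradient_fwd gamma0 sxs.
have sprox y := prox_subgradient g_proper g_convex y g_lsc gamma0.
have xhat_dom k : g (xhat k) \is a fin_num.
  case: k => [|k]; first by rewrite (panoc_init iterates); exact: (sprox _).1.
  by rewrite (panoc_xhat iterates); exact: (sprox _).1.
pose C := 2 * (1 + (gamma * Lf) ^+ 2).
have C0 : 0 < C by rewrite mulr_gt0// addr_gt0// exprn_gt0// mulr_gt0.
have fwd_C u : enorm (fwd gamma f u - fwd gamma f xs) ^+ 2 <= C * enorm (u - xs) ^+ 2.
  exact: fwd_lipschitz.
(* The superlinearity hypothesis in squared form, with the distance of [xbar k]
   replaced by that of [xhat k] at the cost of the Lipschitz factor [C]. *)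
have [bar_neq0 bar_cvg] := dbar_superlinear.
have dir (e : R) : 0 < e -> \forall k \near \oo,
    enorm (xbar k + dbar k - fwd gamma f xs) ^+ 2 <= e * enorm (xhat k - xs) ^+ 2.
  move=> e0; pose r := Num.sqrt (e / C).
  have r0 : 0 < r by rewrite sqrtr_gt0 divr_gt0.
  have bar_small := (cvgrPdist_le _ _).1 bar_cvg r r0.
  near=> k.
  have vk : 0 < enorm (xbar k - fwd gamma f xs).
    by rewrite lt_neqAle enorm_ge0 andbT eq_sym; near: k.
  have : `|0 - enorm (xbar k + dbar k - fwd gamma f xs) /
      enorm (xbar k - fwd gamma f xs)| <= r.
    by near: k; exact: bar_small.
  rewrite sub0r normrN ger0_norm ?divr_ge0 ?enorm_ge0// ler_pdivrMr// => h.
  have : enorm (xbar k + dbar k - fwd gamma f xs) ^+ 2 <=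
     (r * enorm (xbar k - fwd gamma f xs)) ^+ 2.
    by rewrite ler_pXn2r ?nnegrE ?mulr_ge0 ?enorm_ge0 ?(ltW r0).
  move/le_trans; apply; rewrite exprMn sqr_sqrtr; last first.
    by rewrite divr_ge0 ?(ltW e0) ?(ltW C0).
  rewrite (panoc_xbar iterates) -mulrA ler_pM2l//.
  by rewrite -(ler_pM2l C0) mulrA mulfV ?gt_eqF// mul1r.
(* Nonexpansiveness makes the forward-backward images converge to [xs] as well,
   so that local minimality eventually applies to them. *)
have T_cvg : prox gamma g (xbar k) @[k --> \oo] --> xs.
  apply/cvg_enormP.
  have h0 : Num.sqrt C * enorm (xhat k - xs) @[k --> \oo] --> Num.sqrt C * 0.
    by apply: cvgMl_tmp; exact/cvg_enormP.
  rewrite mulr0 in h0; apply: (squeeze_cvgr _ (cvg_cst 0) h0).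
  near=> k; rewrite enorm_ge0/=.
  apply: (le_trans (prox_nonexpansive gamma0 (sprox _) sxs')).
  rewrite -(@ler_pXn2r _ 2)// ?nnegrE ?mulr_ge0 ?sqrtr_ge0 ?enorm_ge0//.
  by rewrite exprMn (sqr_sqrtr (ltW C0)) (panoc_xbar iterates) fwd_C.
have tau1 : \forall k \near \oo, tau k = 1.
  have e0 : 0 < (1 - sigma / (gamma * ((2 - gamma * Lf) / 2))) * (gamma * (mu / 2)).
    rewrite mulr_gt0 ?mulr_gt0 ?divr_gt0// subr_gt0 ltr_pdivrMr ?mul1r//.
    exact: lt_trans sigma_delta.
  near=> k.
  have acc : linesearch gamma sigma f g (xhat k) (dbar k) (beta ^+ 0).
    rewrite expr0.
    apply: (unit_step_accepted f_diff f_lip Lf_gt0 gamma0 gammaL g_proper g_convex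
      g_lsc sigma0 sigma_delta sxs (xhat_dom k) (mu := mu)).
    - by near: k; exact: (xhat_cvg _ growth).
    - by rewrite -(panoc_xbar iterates); near: k; exact: (T_cvg _ xs_loc).
    - by rewrite -(panoc_xbar iterates); near: k; exact: dir.
  apply/eqP; rewrite eq_le -{2}(expr0 beta) (panoc_tau_largest iterates acc) andbT.
  have [i ->] := panoc_tau_pow iterates k.
  by case/andP: beta_itv => b0 b1; rewrite exprn_ile1 ?ltW.
have xhat_neq : \forall k \near \oo, enorm (xhat k - xs) != 0.
  apply: filterS bar_neq0 => k; apply: contraNneq => xk.
  have := fwd_C (xhat k); rewrite (panoc_xbar iterates) xk expr0n/= mulr0 => h.
  by rewrite -sqrf_eq0 eq_le h sqr_ge0.
do 2!split => //.
apply/cvgrPdist_le => e e0; near=> k.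
rewrite sub0r normrN ger0_norm ?divr_ge0 ?enorm_ge0//.
have vk : 0 < enorm (xhat k - xs).
  by rewrite lt_neqAle enorm_ge0 andbT eq_sym; near: k.
rewrite ler_pdivrMr//.
have tk : tau k = 1 by near: k.
rewrite (panoc_xhat iterates).
apply: (le_trans (prox_nonexpansive gamma0 (sprox _) sxs')).
rewrite (panoc_x iterates) tk scale1r.
rewrite -(@ler_pXn2r _ 2)// ?nnegrE ?mulr_ge0 ?enorm_ge0 ?(ltW e0)// exprMn.
by near: k; apply: dir; rewrite exprn_gt0.
Unshelve. all: by end_near.
Qed.
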